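(* For $\mathrm{FOT}^{-}$ in the empty signature, the following problems are decidable: (1) given a formula, whether it is satisfied by some nonempty team (over some model); (2) given a formula, whether it is valid, i.e. satisfied by every team over every model; (3) given two formulas $\varphi,\psi$, whether they are equivalent, i.e. whether for every model $M$ and every team $X$ over $M$ we have $M,X\models\varphi$ iff $M,X\models\psi$.
   Context: Structures $M$ have nonempty domain; the same letter denotes a structure and its domain. An assignment over $M$ is a map from a finite set of variables to $M$. A team over $M$ is a set of assignments with a common domain; the empty team is allowed. $s(a/x)$ is the assignment mapping $x$ to $a$ and otherwise agreeing with $s$; $X(a/x)=\{s(a/x):s\in X\}$. Formulas of $\mathrm{FOT}^{-}$: $\varphi::=\lambda\mid\dot\sim\varphi\mid(\varphi\land\varphi)\mid(\varphi\vee_w\varphi)\mid\exists^1x\,\varphi\mid\forall^1x\,\varphi$, where $\lambda$ is a first-order atomic formula (including equality atoms). In the empty signature the only atoms are equalities between variables. Satisfaction $M,X\models\varphi$ (teams are always taken with domain containing the free variables of the formulas considered): - $M,X\models\lambda$ iff every $s\in X$ satisfies $\lambda$ in $M$ in the usual first-order sense; - $M,X\models\dot\sim\varphi$ iff $X=\emptyset$ or $M,X\not\models\varphi$; - $M,X\models\varphi\land\psi$ iff $M,X\models\varphi$ and $M,X\models\psi$; - $M,X\models\varphi\vee_w\psi$ iff $M,X\models\varphi$ or $M,X\models\psi$; - $M,X\models\exists^1x\,\varphi$ iff $M,X(a/x)\models\varphi$ for some $a\in M$; - $M,X\models\forall^1x\,\varphi$ iff $M,X(a/x)\models\varphi$ for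 all $a\in M$. *)

(* Defs.v *)
From mathcomp Require Import all_boot finmap.
From mathcomp Require Import classical_sets.

Set Implicit Arguments.
Unset Strict Implicit.
Unset Printing Implicit Defensive.

Local Open Scope classical_set_scope.
Local Open Scope fset_scope.
Local Open Scope nat_scope.

(* FOT^- in the empty signature, with variables x_0, x_1, ... named by nat. *)
Inductive formula : Type :=
| FEq of nat & nat
| FNeg of formula
| FAnd of formula & formula
| FOr of formula & formula
| FEx of nat & formula
| FAll of nat & formula.

Fixpoint free_vars (phi : formula) : {fset nat} :=
  match phi with
  | FEq x y => [fset x; y]
  | FNeg p => free_vars p
  | FAnd p q | FOr p q => free_vars p `|` free_vars q
  | FEx x p | FAll x p => free_vars p `\ x
  end.

Definition assignment (M : Type) : Type := {fmap nat -> M}.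

(* The empty set of assignments is a team with domain D for every D. *)
Definition team_on (M : Type) (D : {fset nat}) (X : set (assignment M)) : Prop :=
  forall s, X s -> domf s = D.

Definition team_update (M : Type) (X : set (assignment M)) (x : nat) (a : M) :
  set (assignment M) := [set s.[x <- a]%fmap | s in X].

(* In the FEq case both look-ups are Some as soon as the domain of X contains
   x and y; the definitions below only consider such teams. *)
Fixpoint sat (M : Type) (X : set (assignment M)) (phi : formula) : Prop :=
  match phi with
  | FEq x y => forall s, X s -> s.[? x]%fmap = s.[? y]%fmap
  | FNeg p => X = set0 \/ ~ sat X p
  | FAnd p q => sat X p /\ sat X q
  | FOr p q => sat X p \/ sat X q
  | FEx x p => exists a : M, sat (team_update X x a) p
  | FAll x p => forall a : M, sat (team_update X x a) p
  end.

Definition satisfiable (phi : formula) : Prop :=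
  exists (M : Type) (D : {fset nat}) (X : set (assignment M)),
    [/\ inhabited M, free_vars phi `<=` D, team_on D X, X !=set0 & sat X phi].

Definition valid (phi : formula) : Prop :=
  forall (M : Type) (D : {fset nat}) (X : set (assignment M)),
    inhabited M -> free_vars phi `<=` D -> team_on D X -> sat X phi.

Definition equivalent (phi psi : formula) : Prop :=
  forall (M : Type) (D : {fset nat}) (X : set (assignment M)),
    inhabited M -> free_vars phi `|` free_vars psi `<=` D -> team_on D X ->
    (sat X phi <-> sat X psi).

(* primrec f g k v = h(k, v), where h(0, v) = f(v) and
   h(k + 1, v) = g(k, h(k, v), v). *)
Fixpoint primrec n (f : n.-tuple nat -> nat) (g : n.+2.-tuple nat -> nat)
    (k : nat) (v : n.-tuple nat) : nat :=
  if k is k'.+1 then g [tuple of k' :: primrec f g k' v :: v] else f v.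

(* Kleene's total recursive functions. In rec_min the value g v is the least
   zero of f( . , v), so that minimization is applied to regular functions
   only. Decidability cannot be stated as the existence of an arbitrary
   function formula -> bool: under classical logic and choice, every predicate
   has one. *)
Inductive recursive : forall n, (n.-tuple nat -> nat) -> Prop :=
| rec_zero n : recursive (fun _ : n.-tuple nat => 0)
| rec_succ : recursive (fun v : 1.-tuple nat => (thead v).+1)
| rec_proj n (i : 'I_n) : recursive (fun v : n.-tuple nat => tnth v i)
| rec_comp m n (f : m.-tuple nat -> nat) (g : 'I_m -> n.-tuple nat -> nat) :
    recursive f -> (forall i, recursive (g i)) ->
    recursive (fun v : n.-tuple nat => f [tuple g i v | i < m])
| rec_prim n (f : n.-tuple nat -> nat) (g : n.+2.-tuple nat -> nat) :
    recursive f -> recursive g ->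
    recursive (fun v : n.+1.-tuple nat =>
      primrec f g (thead v) [tuple of behead v])
| rec_min n (f : n.+1.-tuple nat -> nat) (g : n.-tuple nat -> nat) :
    recursive f ->
    (forall v, f [tuple of g v :: v] = 0 /\
               forall y, y < g v -> f [tuple of y :: v] <> 0) ->
    recursive g.

(* Goedel numbering; CodeSeq.code is the computable bijection from seq nat to
   nat given by code [::] = 0 and code (n :: s) = 2 ^ n * (2 * code s + 1). *)
Fixpoint goedel (phi : formula) : nat :=
  match phi with
  | FEq x y => CodeSeq.code [:: 0; x; y]
  | FNeg p => CodeSeq.code [:: 1; goedel p]
  | FAnd p q => CodeSeq.code [:: 2; goedel p; goedel q]
  | FOr p q => CodeSeq.code [:: 3; goedel p; goedel q]
  | FEx x p => CodeSeq.code [:: 4; x; goedel p]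
  | FAll x p => CodeSeq.code [:: 5; x; goedel p]
  end.

Lemma goedel_inj : injective goedel.
Proof.
have inj := can_inj CodeSeq.codeK.
elim=> [x y|p IH|p IHp q IHq|p IHp q IHq|x p IH|x p IH]
  [x' y'|p'|p' q'|p' q'|x' p'|x' p'] /inj [] //.
- by move=> -> ->.
- by move=> /IH ->.
- by move=> /IHp -> /IHq ->.
- by move=> /IHp -> /IHq ->.
- by move=> -> /IH ->.
- by move=> -> /IH ->.
Qed.

Definition decidable1 (P : formula -> Prop) : Prop :=
  exists chi : 1.-tuple nat -> nat, recursive chi /\
    forall phi, (P phi -> chi [tuple goedel phi] = 1) /\
                (~ P phi -> chi [tuple goedel phi] = 0).

Definition decidable2 (P : formula -> formula -> Prop) : Prop :=
  exists chi : 2.-tuple nat -> nat, recursive chi /\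
    forall phi psi,
      (P phi psi -> chi [tuple goedel phi; goedel psi] = 1) /\
      (~ P phi psi -> chi [tuple goedel phi; goedel psi] = 0).

(* Main.v *)
From mathcomp Require Import all_boot finmap.
From mathcomp Require Import boolp classical_sets.
From mathcomp Require Import zify.
Require Import Defs.

Set Implicit Arguments.
Unset Strict Implicit.
Unset Printing Implicit Defensive.
Local Open Scope classical_set_scope.
Local Open Scope nat_scope.

(* On a nonempty team a formula only sees which variables agree throughout the
   team and which are constant, and a quantified variable is always constant.
   So a formula with N variables is evaluated like a first-order formula of
   pure equality over a domain of constants, enlarged by one extra object for
   each class of non-constant variables, with quantifiers restricted to the
   constants. A back-and-forth argument shows that domains with at least N
   elements are indistinguishable, so satisfiability by a nonempty team is a
   bounded search for a domain size m <= N and a valuation. If m = 1, every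
   variable is constant; if m >= 2, every valuation comes from a team. Finally,
   the empty team satisfies every formula and negation is classical on the
   other teams, so validity and equivalence reduce to satisfiability. *)

(* A function of an infinite environment is computable when its restrictions to
   finite environments padded with 0 are; de Bruijn style indexing then makes
   substitution under binders a conversion. *)
Definition computable (F : (nat -> nat) -> nat) : Prop :=
  forall n, recursive (fun v : n.-tuple nat => F (nth 0 v)).

(** * Closure properties of the computable functions *)

Lemma computable_var i : computable (fun r => r i).
Proof.
move=> n; have [ltin|lein] := ltnP i n.
  suff -> : (fun v : n.-tuple nat => nth 0 v i) = fun v =>
      tnth v (Ordinal ltin).
    exact: rec_proj.
  by apply/funext => v; rewrite (tnth_nth 0).
suff -> : (fun v : n.-tuple nat => nth 0 v i) = fun=> 0 by exact: rec_zero.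
by apply/funext => v; rewrite nth_default // size_tuple.
Qed.

(** On padded n-tuples the new environment vanishes from some m on, so it is itself a padded m-tuple
    and Kleene composition applies. *)
Lemma computable_subst F (G : nat -> (nat -> nat) -> nat) :
  computable F -> (forall i, computable (G i)) ->
  (forall n, exists m, forall (v : n.-tuple nat) i, m <= i ->
     G i (nth 0 v) = 0) ->
  computable (fun r => F (fun i => G i r)).
Proof.
move=> cF cG G0 n; have [m Gm] := G0 n.
have := rec_comp (cF m) (fun i : 'I_m => cG i n).
congr recursive; apply/funext => v; congr F; apply/funext => i.
have [ltim|leim] := ltnP i m; last by rewrite nth_default ?size_tuple ?Gm.
by rewrite -[i]/(val (Ordinal ltim)) -tnth_nth tnth_mktuple.
Qed.

Lemma computable_0 : computable (fun=> 0).
Proof. by move=> n; exact: rec_zero. Qed.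

Lemma computable_comp F (G : seq ((nat -> nat) -> nat)) :
  computable F -> (forall i, computable (nth (fun=> 0) G i)) ->
  computable (fun r => F (fun i => nth (fun=> 0) G i r)).
Proof.
move=> cF cG; apply: computable_subst => // n.
by exists (size G) => v i leGi; rewrite nth_default.
Qed.

Lemma computable_comp1 f F :
  computable (fun r => f (r 0)) -> computable F -> computable (fun r =>
      f (F r)).
Proof.
move=> cf cF; apply: (computable_comp (G := [:: F]) cf) => -[|i] //=.
by rewrite nth_nil; exact: computable_0.
Qed.

Lemma computable_comp2 f F G :
  computable (fun r => f (r 0) (r 1)) -> computable F -> computable G ->
  computable (fun r => f (F r) (G r)).
Proof.
move=> cf cF cG.
apply: (computable_comp (G := [:: F; G]) cf) => -[|[|i]] //=.
by rewrite nth_nil; exact: computable_0.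
Qed.

Lemma computable_comp3 f F G H :
  computable (fun r => f (r 0) (r 1) (r 2)) ->
  computable F -> computable G -> computable H ->
  computable (fun r => f (F r) (G r) (H r)).
Proof.
move=> cf cF cG cH.
apply: (computable_comp (G := [:: F; G; H]) cf) => -[|[|[|i]]] //=.
by rewrite nth_nil; exact: computable_0.
Qed.

Lemma computable_comp4 f F G H K :
  computable (fun r => f (r 0) (r 1) (r 2) (r 3)) ->
  computable F -> computable G -> computable H -> computable K ->
  computable (fun r => f (F r) (G r) (H r) (K r)).
Proof.
move=> cf cF cG cH cK.
apply: (computable_comp (G := [:: F; G; H; K]) cf) => -[|[|[|[|i]]]] //=.
by rewrite nth_nil; exact: computable_0.
Qed.

Lemma computable_succ F : computable F -> computable (fun r => (F r).+1).
Proof.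
move=> cF n.
have := rec_comp rec_succ (fun i : 'I_1 => cF n).
congr recursive; apply/funext => v.
by rewrite /thead tnth_mktuple.
Qed.

Lemma computable_const k : computable (fun=> k).
Proof.
by elim: k => [|k /computable_succ//]; exact: computable_0.
Qed.

(** [rec_prim] recurses on the first entry of a tuple, so the count is first made entry 0 of the
    environment and [K] is substituted for it afterwards. *)
Lemma computable_iteri K A B :
  computable K -> computable A ->
  computable (fun r => B (r 0) (r 1) (fun i => r i.+2)) ->
  computable (fun r => iteri (K r) (fun k h => B k h r) (A r)).
Proof.
move=> cK cA cB.
pose F r := iteri (r 0) (fun k h => B k h (fun i => r i.+1)) (A (fun i =>
    r i.+1)).
pose G i : (nat -> nat) -> nat := if i is i'.+1 then fun r => r i' else K.
have cF : computable F.
  (* The empty tuple has no entry to recurse on; padding makes the count 0, and only [A] remains. *)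
  case=> [|n].
    have := cA 0; congr recursive; apply/funext => v; rewrite /F tuple0 /=.
    by congr A; apply/funext => i; rewrite nth_nil.
  have := rec_prim (cA n) (cB n.+2).
  congr recursive; apply/funext => v; case: (tupleP v) => k w.
  have Ew : [tuple of behead [tuple of k :: w]] = w :> n.-tuple nat.
    exact: val_inj.
  by rewrite theadE {}Ew /F; elim: k => [|k] //= ->.
apply: (computable_subst (G := G) cF) => [|n].
  by case=> [|i] //; exact: computable_var.
by exists n.+1 => v [|i] // ltni; rewrite /G nth_default ?size_tuple.
Qed.

Lemma computable_add F G :
  computable F -> computable G -> computable (fun r => F r + G r).
Proof.
apply: computable_comp2.
have -> : (fun r : nat -> nat => r 0 + r 1) =
          fun r => iteri (r 0) (fun _ h => h.+1) (r 1).
  by apply/funext => r; elim: (r 0) => //= k <-.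
apply: (computable_iteri (B := fun _ h _ => h.+1)); try exact: computable_var.
exact/computable_succ/computable_var.
Qed.

Lemma computable_mul F G :
  computable F -> computable G -> computable (fun r => F r * G r).
Proof.
apply: computable_comp2.
have -> : (fun r : nat -> nat => r 0 * r 1) =
          fun r => iteri (r 0) (fun _ h => r 1 + h) 0.
  by apply/funext => r; elim: (r 0) => //= k <-; rewrite mulSn.
apply: (computable_iteri (B := fun _ h r => r 1 + h)).
- exact: computable_var.
- exact: computable_const.
- by apply: computable_add; exact: computable_var.
Qed.

Lemma computable_exp F G :
  computable F -> computable G -> computable (fun r => F r ^ G r).
Proof.
apply: computable_comp2.
have -> : (fun r : nat -> nat => r 0 ^ r 1) =
          fun r => iteri (r 1) (fun _ h => r 0 * h) 1.
  by apply/funext => r; elim: (r 1) => //= k <-; rewrite expnS.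
apply: (computable_iteri (B := fun _ h r => r 0 * h)).
- exact: computable_var.
- exact: computable_const.
- by apply: computable_mul; exact: computable_var.
Qed.

Lemma computable_sub F G :
  computable F -> computable G -> computable (fun r => F r - G r).
Proof.
apply: computable_comp2.
have -> : (fun r : nat -> nat => r 0 - r 1) =
          fun r => iteri (r 1) (fun _ h => h.-1) (r 0).
  by apply/funext => r; elim: (r 1) => [|k /= <-]; rewrite ?subn0 ?subnS.
apply: (computable_iteri (B := fun _ h _ => h.-1)); try exact: computable_var.
apply: (computable_comp1 (f := predn)); last exact: computable_var.
have -> : (fun r : nat -> nat => (r 0).-1) =
          fun r => iteri (r 0) (fun k _ => k) 0.
  by apply/funext => r; case: (r 0).
apply: (computable_iteri (B := fun k _ _ => k)); try exact: computable_var.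
exact: computable_const.
Qed.

Lemma computable_neg (P : (nat -> nat) -> bool) :
  computable P -> computable (fun r => ~~ P r).
Proof.
move=> cP.
have -> : (fun r => nat_of_bool (~~ P r)) = fun r => 1 - P r.
  by apply/funext => r; case: (P r).
by apply: computable_sub => //; exact: computable_const.
Qed.

Lemma computable_and (P Q : (nat -> nat) -> bool) :
  computable P -> computable Q -> computable (fun r => P r && Q r).
Proof.
move=> cP cQ.
have -> : (fun r => nat_of_bool (P r && Q r)) = fun r => P r * Q r.
  by apply/funext => r; rewrite mulnb.
exact: computable_mul.
Qed.

Lemma computable_or (P Q : (nat -> nat) -> bool) :
  computable P -> computable Q -> computable (fun r => P r || Q r).
Proof.
move=> cP cQ.
have -> : (fun r => nat_of_bool (P r || Q r)) =
          fun r => ~~ (~~ P r && ~~ Q r).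
  by apply/funext => r; rewrite negb_and !negbK.
by apply/computable_neg/computable_and; exact: computable_neg.
Qed.

Lemma computable_leq F G :
  computable F -> computable G -> computable (fun r => F r <= G r).
Proof.
move=> cF cG.
have -> : (fun r => nat_of_bool (F r <= G r)) = fun r => 1 - (F r - G r).
  by apply/funext => r; rewrite -subn_eq0; case: (F r - G r).
by apply: computable_sub; [exact: computable_const | exact: computable_sub].
Qed.

Lemma computable_eq F G :
  computable F -> computable G -> computable (fun r => F r == G r).
Proof.
move=> cF cG.
have -> : (fun r => nat_of_bool (F r == G r)) =
          fun r => (F r <= G r) && (G r <= F r).
  by apply/funext => r; rewrite eqn_leq.
by apply: computable_and; exact: computable_leq.
Qed.

Lemma computable_count K (P : nat -> (nat -> nat) -> bool) :
  computable K -> computable (fun r => P (r 0) (fun i => r i.+1)) ->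
  computable (fun r => count (fun i => P i r) (iota 0 (K r))).
Proof.
move=> cK cP.
have -> : (fun r => count (fun i => P i r) (iota 0 (K r))) =
          fun r => iteri (K r) (fun k h => h + P k r) 0.
  apply/funext => r; elim: (K r) => // k IH.
  by rewrite -{1}[k.+1]addn1 iotaD count_cat IH /= addn0.
apply: (computable_iteri (B := fun k h r => h + P k r)) => //.
  exact: computable_const.
apply: computable_add; first exact: computable_var.
(* The body of the iteration sees the accumulator as entry 1, which [P] has to skip. *)
pose G i : (nat -> nat) -> nat :=
    if i is i'.+1 then fun r => r i'.+2 else fun r => r 0.
apply: (computable_subst (G := G) cP) => [|n].
  by case=> [|i]; exact: computable_var.
exists n.+1 => v [|i] // ltni; rewrite /G nth_default // size_tuple; lia.
Qed.

Lemma computable_has K (P : nat -> (nat -> nat) -> bool) :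
  computable K -> computable (fun r => P (r 0) (fun i => r i.+1)) ->
  computable (fun r => has (fun i => P i r) (iota 0 (K r))).
Proof.
move=> cK cP.
have -> : (fun r => nat_of_bool (has (fun i => P i r) (iota 0 (K r)))) =
          fun r => 0 < count (fun i => P i r) (iota 0 (K r)).
  by apply/funext => r; rewrite has_count.
by apply: computable_leq; [exact: computable_const | exact: computable_count].
Qed.

Lemma computable_all K (P : nat -> (nat -> nat) -> bool) :
  computable K -> computable (fun r => P (r 0) (fun i => r i.+1)) ->
  computable (fun r => all (fun i => P i r) (iota 0 (K r))).
Proof.
move=> cK cP.
have -> : (fun r => nat_of_bool (all (fun i => P i r) (iota 0 (K r)))) =
          fun r => ~~ has (fun i => ~~ P i r) (iota 0 (K r)).
  by apply/funext => r; rewrite -all_predC; congr nat_of_bool;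
      apply: eq_all => i /=; rewrite negbK.
apply: computable_neg; apply: (computable_has (P := fun i r => ~~ P i r)) => //.
exact: computable_neg.
Qed.

Lemma count_ltn_iota k n : count (ltn^~ k) (iota 0 n) = minn k n.
Proof.
elim: n => [|n IH]; first by rewrite minn0.
by rewrite -[n.+1]addn1 iotaD count_cat IH /=; lia.
Qed.

(** For d > 0 the quotient of n by d is the number of q with (q + 1) d <= n; the factor [0 < r 1]
    makes division by 0 yield 0. *)
Lemma computable_div F G :
  computable F -> computable G -> computable (fun r => F r %/ G r).
Proof.
apply: computable_comp2.
have -> : (fun r : nat -> nat => r 0 %/ r 1) =
    fun r => (0 < r 1) * count (fun q => q.+1 * r 1 <= r 0) (iota 0 (r 0)).
  apply/funext => r; have [->|d_gt0] := posnP (r 1); first by rewrite divn0.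
  rewrite (eq_count (a2 := ltn^~ (r 0 %/ r 1))).
    by rewrite count_ltn_iota mul1n (minn_idPl (leq_div _ _)).
  by move=> q /=; rewrite leq_divRL.
apply: computable_mul.
  by apply: computable_leq; [exact: computable_const | exact: computable_var].
apply: (computable_count (P := fun q r => q.+1 * r 1 <= r 0)).
  exact: computable_var.
apply: computable_leq; last exact: computable_var.
apply: computable_mul; last exact: computable_var.
exact/computable_succ/computable_var.
Qed.

Lemma computable_mod F G :
  computable F -> computable G -> computable (fun r => F r %% G r).
Proof.
move=> cF cG.
have -> : (fun r => F r %% G r) = fun r => F r - F r %/ G r * G r.
  by apply/funext => r; rewrite {2}(divn_eq (F r) (G r)) addKn.
apply: computable_sub => //; apply: computable_mul => //.
exact: computable_div.
Qed.

Lemma computable_logn2 F : computable F -> computable (fun r => logn 2 (F r)).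
Proof.
apply: (computable_comp1 (f := logn 2)).
have -> : (fun r : nat -> nat => logn 2 (r 0)) = fun r =>
    (0 < r 0) * count (fun i => r 0 %% 2 ^ i.+1 == 0) (iota 0 (r 0).-1).
  apply/funext => r; case: (r 0) => // n.
  rewrite logn_count_dvd // mul1n /= big_add1 /= -sum1_count [RHS]big_mkcond.
  by rewrite /index_iota subn0; apply: eq_bigr => i _; rewrite /dvdn; case: eqP.
apply: computable_mul.
  by apply: computable_leq; [exact: computable_const | exact: computable_var].
apply: (computable_count (P := fun i r => r 0 %% 2 ^ i.+1 == 0)).
  rewrite (_ : (fun r => _) = fun r : nat -> nat => r 0 - 1); last first.
    by apply/funext => r; rewrite subn1.
  by apply: computable_sub; [exact: computable_var | exact: computable_const].
apply: computable_eq; last exact: computable_const.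
apply: computable_mod; first exact: computable_var.
apply: computable_exp; first exact: computable_const.
exact/computable_succ/computable_var.
Qed.

(** * A computable evaluator for coded formulas *)

(** The code of a nonempty sequence is 2 ^ head times an odd number, whose half, rounded down, is
    the code of the tail. *)
Definition code_head c := logn 2 c.
Definition code_tail c := c %/ 2 ^ logn 2 c %/ 2.

Lemma code_headE n s : code_head (CodeSeq.code (n :: s)) = n.
Proof.
rewrite /code_head /= lognM ?expn_gt0 // pfactorK // lognE /=.
by rewrite dvdn2 /= odd_double addn0.
Qed.

Lemma code_tailE n s : code_tail (CodeSeq.code (n :: s)) = CodeSeq.code s.
Proof.
rewrite /code_tail -/(code_head _) code_headE /= mulKn ?expn_gt0 //.
by rewrite divn2 /= uphalf_double.
Qed.

(* Valuations of N variables are numbers written in base 2 N. *)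
Definition digit b e y := e %/ b ^ y %% b.

Lemma digitsP b N (f : nat -> nat) : (forall y, y < N -> f y < b) ->
  exists2 e, e < b ^ N & forall y, y < N -> digit b e y = f y.
Proof.
elim: N f => [|N IH] f fb; first by exists 0.
have [e eb ef] := IH (fun y => f y.+1) (fun y => fb y.+1).
have f0b := fb 0 isT; have b_gt0 : 0 < b by lia.
exists (f 0 + b * e); first by rewrite expnS; nia.
case=> [|y] ltyN; rewrite /digit;
    first by rewrite divn1 mulnC addnC modnMDl modn_small.
rewrite expnS divnMA addnC mulnC divnMDl // (divn_small f0b) addn0.
exact: ef.
Qed.

(* [digit _ e' x] is left free: quantifiers search over whole valuations. *)
Definition variant N x e e' :=
  all (fun y => (y == x) || (digit (N + N) e' y == digit (N + N) e y))
    (iota 0 N).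

(** One unfolding of the truth definition, with [look] as an oracle for the subformulas. The
    disjunction over the constructor tag [t] makes it visibly a composition of computable
    operations. *)
Definition step N m (look : nat -> nat -> bool) c e : bool :=
  let b := N + N in
  let t := code_head c in
  let u := code_head (code_tail c) in
  let w := code_head (code_tail (code_tail c)) in
  [|| (t == 0) && (digit b e u == digit b e w),
      (t == 1) && ~~ look u e,
      (t == 2) && (look u e && look w e),
      (t == 3) && (look u e || look w e),
      (t == 4) && has (fun e' =>
          [&& variant N u e e', digit b e' u < m & look w e'])
        (iota 0 (b ^ N)) |
      (t == 5) && all (fun e' =>
          ~~ (variant N u e e' && (digit b e' u < m)) || look w e')
        (iota 0 (b ^ N))].

Definition row N c e := c * (N + N) ^ N + e.

Definition entry N m i h : bool :=
  step N m (fun c e => digit 2 h (row N c e) == 1)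
    (i %/ (N + N) ^ N) (i %% (N + N) ^ N).

(* Course-of-values recursion: bit i of [table N m k] is the truth value of the
   i-th pair (formula, valuation), for i < k. Subformulas have smaller codes,
   so a row only refers to lower bits. *)
Definition table N m k := iteri k (fun i h => h + 2 ^ i * entry N m i h) 0.

Definition truth N m c e : bool :=
  entry N m (row N c e) (table N m (row N c e)).

(* The domain has m.+1 elements. If m = 0, then e = 0 says that every variable
   denotes the only constant. *)
Definition satb c : bool :=
  has (fun m => has (fun e => ((0 < m) || (e == 0)) && truth c.+2 m.+1 c e)
    (iota 0 ((c.+2 + c.+2) ^ c.+2))) (iota 0 c.+2).

Ltac computability :=
  lazymatch goal with
  | |- computable (fun r => nat_of_bool (_ == _)) => apply: computable_eq
  | |- computable (fun r => nat_of_bool (~~ _)) => apply: computable_neg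
  | |- computable (fun r => nat_of_bool (_ && _)) => apply: computable_and
  | |- computable (fun r => nat_of_bool (_ || _)) => apply: computable_or
  | |- computable (fun r => nat_of_bool (_ <= _)) => apply: computable_leq
  | |- computable (fun r => _ + _) => apply: computable_add
  | |- computable (fun r => _ * _) => apply: computable_mul
  | |- computable (fun r => _ ^ _) => apply: computable_exp
  | |- computable (fun r => _ %/ _) => apply: computable_div
  | |- computable (fun r => _ %% _) => apply: computable_mod
  | |- computable (fun r => logn 2 _) => apply: computable_logn2
  | |- computable (fun r => S _) => apply: computable_succ
  | |- computable (fun r => nat_of_bool (has _ (iota 0 _))) =>
      apply: computable_has
  | |- computable (fun r => nat_of_bool (all _ (iota 0 _))) =>
      apply: computable_all
  | |- computable (fun r => r _) => apply: computable_var
  | |- computable (fun r => _) => apply: computable_const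
  end; cbn beta.

Lemma computable_entry F G H K :
  computable F -> computable G -> computable H -> computable K ->
  computable (fun r => entry (F r) (G r) (H r) (K r)).
Proof.
apply: (computable_comp4 (f := fun N m i h => entry N m i h)).
rewrite /entry /step /variant /row /digit /code_head /code_tail; cbv zeta beta.
by repeat computability.
Qed.

Lemma computable_table F G H :
  computable F -> computable G -> computable H ->
  computable (fun r => table (F r) (G r) (H r)).
Proof.
apply: computable_comp3.
apply: (computable_iteri (B := fun i h r => h + 2 ^ i * entry (r 0) (r 1) i h)).
- exact: computable_var.
- exact: computable_const.
repeat computability.
by apply: computable_entry; repeat computability.
Qed.

Lemma computable_satb F : computable F -> computable (fun r => satb (F r)).
Proof.
apply: (computable_comp1 (f := fun c => satb c)); rewrite /satb /truth /row.
repeat computability.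
by apply: computable_entry; try apply: computable_table; repeat computability.
Qed.

(** * Correctness of the course-of-values recursion *)

Lemma code_head_leq c : code_head c <= c.
Proof.
rewrite /code_head; have [->|c_gt0] := posnP c; first by [].
exact/ltnW/ltn_logl.
Qed.

Lemma code_tail_ltn c : 0 < c -> code_tail c < c.
Proof.
by move=> c_gt0; rewrite /code_tail -divnMA ltn_Pdiv // muln2 -addnn;
  have : 0 < 2 ^ logn 2 c; rewrite ?expn_gt0 //; lia.
Qed.

Lemma table_ltn N m k : table N m k < 2 ^ k.
Proof.
elim: k => //= k; rewrite /table expnS /=.
by case: (entry _ _ _ _); lia.
Qed.

(** Bit j is written at stage j, on top of a number below 2 ^ j; every later stage adds a multiple
    of 2 ^ (j + 1). *)
Lemma digit_table N m j k : j < k ->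
  (digit 2 (table N m k) j == 1) = entry N m j (table N m j).
Proof.
elim: k => // k IH; rewrite ltnS leq_eqVlt => /predU1P[->|ltjk].
  rewrite {1}/table /= -/(table _ _ _) /digit addnC mulnC.
  rewrite divnMDl ?expn_gt0 // divn_small ?table_ltn // addn0.
  by case: (entry _ _ _ _).
rewrite -(IH ltjk) {1}/table /= -/(table _ _ _) /digit.
congr (_ == 1); rewrite -(subnK (ltnW ltjk)) expnD mulnAC addnC.
rewrite divnMDl ?expn_gt0 //.
have -> : k - j = (k - j.+1).+1 by lia.
by rewrite expnS -mulnA mulnC modnMDl.
Qed.

(** The oracle is asked only about heads of iterated tails of [c], which lie below [c] whether or
    not [c] codes a formula. *)
Lemma eq_step N m (look1 look2 : nat -> nat -> bool) c e :
  0 < c -> e < (N + N) ^ N ->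
  (forall p e', p < c -> e' < (N + N) ^ N -> look1 p e' = look2 p e') ->
  step N m look1 c e = step N m look2 c e.
Proof.
move=> c_gt0 ltB eq12; rewrite /step.
have lt1 := code_tail_ltn c_gt0.
have ltu : code_head (code_tail c) < c by apply:
    leq_ltn_trans (code_head_leq _) lt1.
have ltw : code_head (code_tail (code_tail c)) < c.
  have [->|/code_tail_ltn lt2] := posnP (code_tail c); first by [].
  exact: leq_ltn_trans (code_head_leq _) (ltn_trans lt2 lt1).
rewrite !eq12 //; congr [|| _, _, _, _, _ && _ | _ && _].
  by apply: eq_in_has => e'; rewrite mem_iota => /andP[_ lte']; rewrite eq12.
by apply: eq_in_all => e'; rewrite mem_iota => /andP[_ lte']; rewrite eq12.
Qed.

(** With B valuations, p < c gives [p * B + e' < (p + 1) * B <= c * B], so the bits asked for are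
    already in the table. *)
Lemma truth_step N m c e : 0 < c -> e < (N + N) ^ N ->
  truth N m c e = step N m (truth N m) c e.
Proof.
move=> c_gt0 ltB; rewrite /truth {1}/entry {2 3}/row.
have B_gt0 : 0 < (N + N) ^ N by lia.
rewrite divnMDl // (divn_small ltB) addn0 modnMDl (modn_small ltB).
apply: eq_step => // p e' ltpc lte'; rewrite digit_table // /row.
by nia.
Qed.

Lemma goedel_gt0 phi : 0 < goedel phi.
Proof. by case: phi => *; rewrite /= muln_gt0 expn_gt0. Qed.

Lemma goedelE phi :
  [/\ code_head (goedel phi) = match phi with
        FEq _ _ => 0 | FNeg _ => 1 | FAnd _ _ => 2 | FOr _ _ => 3
        | FEx _ _ => 4 | FAll _ _ => 5 end,
      code_head (code_tail (goedel phi)) = match phi with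
        FEq x _ | FEx x _ | FAll x _ => x
        | FNeg p | FAnd p _ | FOr p _ => goedel p end &
      code_head (code_tail (code_tail (goedel phi))) = match phi with
        FEq _ y => y | FNeg _ => 0
        | FAnd _ p | FOr _ p | FEx _ p | FAll _ p => goedel p end].
Proof.
by case: phi => *; cbn [goedel]; rewrite !(code_tailE, code_headE).
Qed.

(** Every entry of a sequence is below its code. This drives the recursion on subformulas and bounds
    all variable indices, quantified ones included. *)
Lemma goedel_ltn phi : match phi with
    FEq x y => x < goedel phi /\ y < goedel phi
    | FNeg p => goedel p < goedel phi
    | FAnd p q | FOr p q => goedel p < goedel phi /\ goedel q < goedel phi
    | FEx x p | FAll x p => x < goedel phi /\ goedel p < goedel phi end.
Proof.
case: phi => [x y|p|p q|p q|x p|x p]; cbn [goedel].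
- by case/and4P: (CodeSeq.ltn_code [:: 0; x; y]).
- by case/and3P: (CodeSeq.ltn_code [:: 1; goedel p]).
- by case/and4P: (CodeSeq.ltn_code [:: 2; goedel p; goedel q]).
- by case/and4P: (CodeSeq.ltn_code [:: 3; goedel p; goedel q]).
- by case/and4P: (CodeSeq.ltn_code [:: 4; x; goedel p]).
- by case/and4P: (CodeSeq.ltn_code [:: 5; x; goedel p]).
Qed.

Lemma truth_goedel N m phi e : e < (N + N) ^ N ->
  truth N m (goedel phi) e = match phi with
    | FEq x y => digit (N + N) e x == digit (N + N) e y
    | FNeg p => ~~ truth N m (goedel p) e
    | FAnd p q => truth N m (goedel p) e && truth N m (goedel q) e
    | FOr p q => truth N m (goedel p) e || truth N m (goedel q) e
    | FEx x p => has (fun e' => [&& variant N x e e', digit (N + N) e' x < m &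
        truth N m (goedel p) e']) (iota 0 ((N + N) ^ N))
    | FAll x p => all (fun e' =>
        ~~ (variant N x e e' && (digit (N + N) e' x < m))
        || truth N m (goedel p) e') (iota 0 ((N + N) ^ N))
    end.
Proof.
move=> ltB; rewrite truth_step ?goedel_gt0 // /step.
by case: (goedelE phi) => -> -> ->; case: phi => * /=; rewrite ?orbF.
Qed.

(** * Abstracting a team to a valuation *)

Lemma free_vars_ltn phi x : x \in free_vars phi -> x < goedel phi.
Proof.
elim: phi => [y z|p IHp|p IHp q IHq|p IHp q IHq|y p IHp|y p IHp];
  cbn [free_vars]; rewrite ?inE.
- by have [? ?] := goedel_ltn (FEq y z) => /orP[]/eqP->.
- by move/IHp/ltn_trans; apply; exact: (goedel_ltn (FNeg p)).
all: do [case/orP=> [xp|xq] | case/andP=> [_ xp]].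
- exact: ltn_trans (IHp xp) (goedel_ltn (FAnd p q)).1.
- exact: ltn_trans (IHq xq) (goedel_ltn (FAnd p q)).2.
- exact: ltn_trans (IHp xp) (goedel_ltn (FOr p q)).1.
- exact: ltn_trans (IHq xq) (goedel_ltn (FOr p q)).2.
- exact: ltn_trans (IHp xp) (goedel_ltn (FEx y p)).2.
- exact: ltn_trans (IHp xp) (goedel_ltn (FAll y p)).2.
Qed.

Definition updf T (f : nat -> T) x k y := if y == x then k else f y.

(* Values below m stand for the constants, named by i; the other values stand
   for the non-constant classes. *)
Record represents (M : Type) N m (i : nat -> M) (X : set (assignment M))
    (A : pred nat) (f : nat -> nat) : Prop := Represents {
  rep_inj : forall k l, k < m -> l < m -> i k = i l -> k = l;
  rep_size : m = N \/ forall a, exists2 k, k < m & i k = a;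
  rep_const : forall x, A x -> forall a,
    (forall s, X s -> s.[? x]%fmap = Some a) <-> f x < m /\ i (f x) = a;
  rep_eq : forall x y, A x -> A y ->
    (forall s, X s -> s.[? x]%fmap = s.[? y]%fmap) <-> f x = f y }.

Lemma represents_sub M N m (i : nat -> M) X (A B : pred nat) f g :
  (forall x, B x -> A x /\ g x = f x) ->
  represents N m i X A f -> represents N m i X B g.
Proof.
move=> BA [inj size const eq];
    split=> // [x /BA[Ax ->]|x y /BA[Ax ->] /BA[Ay ->]].
  exact: const.
exact: eq.
Qed.

Lemma represents_add M N m (i : nat -> M) X (A : pred nat) f x k :
  represents N m i X A f -> ~~ A x ->
  (forall a, (forall s, X s -> s.[? x]%fmap = Some a) <-> k < m /\ i k = a) ->
  (forall y, A y -> (forall s, X s ->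
      s.[? x]%fmap = s.[? y]%fmap) <-> k = f y) ->
  represents N m i X (fun y => (y == x) || A y) (updf f x k).
Proof.
move=> [inj size const eq] NAx constk eqk.
have updE y : A y -> updf f x k y = f y.
  by rewrite /updf; case: eqP => // ->; rewrite (negbTE NAx).
have updx : updf f x k x = k by rewrite /updf eqxx.
split=> // [y /predU1P[->|Ay] a|y z /predU1P[->|Ay] /predU1P[->|Az]].
- by rewrite updx.
- by rewrite updE //; exact: const.
- by split.
- by rewrite updx updE //; exact: eqk.
- rewrite updx updE //; split=> [Xyx|fk].
    by apply/esym/(eqk _ Ay) => s /Xyx.
  by move=> s Xs; apply/esym; move: s Xs; exact/(eqk _ Ay).
- by rewrite !updE //; exact: eq.
Qed.

Lemma updf_inj M m (i : nat -> M) k a :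
  (forall p q, p < m -> q < m -> i p = i q -> p = q) ->
  (forall p, p < m -> p != k -> i p <> a) ->
  forall p q, p < m -> q < m -> updf i k a p = updf i k a q -> p = q.
Proof.
move=> inj Na p q ltp ltq; rewrite /updf.
case: (eqVneq p k) (eqVneq q k) => [->|pk] [->|qk] //.
- by move/esym/(Na _ ltq qk).
- by move/(Na _ ltp pk).
- exact: inj.
Qed.

(** Apart from injectivity, [i] matters only at the names in use, so an idle name can be passed to
    an element that has none. *)
Lemma represents_rename M m (i : nat -> M) X (A : pred nat) f k a :
  represents m m i X A f -> (forall y, A y -> f y <> k) ->
  (forall p, p < m -> i p <> a) ->
  represents m m (updf i k a) X A f.
Proof.
move=> [inj size const eq] Nk Na; split=> //; last 2 first.
- by left.
- move=> x Ax b; rewrite /updf; case: eqP => [/(Nk _ Ax)//|_]; exact: const.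
by apply: updf_inj => // p ltp _; exact: Na.
Qed.

(** Pigeonhole: [A] misses [x], so it has fewer than N members, whose values cannot fill N
    consecutive numbers. With c = m this gives a value to a new non-constant class, with c = 0 an
    idle name for a constant. *)
Lemma fresh_value (A : pred nat) (f : nat -> nat) N x c :
  (forall y, A y -> y < N) -> x < N -> ~~ A x ->
  exists k, [/\ c <= k, k < c + N & forall y, A y -> f y <> k].
Proof.
move=> AN ltxN NAx; set s := [seq f y | y <- iota 0 N & A y].
have [|/hasPn Ns] := boolP (has (fun k => k \notin s) (iota c N)).
  case/hasP => k; rewrite mem_iota => /andP[lek ltk] Nks.
  exists k; split=> // y Ay fyk; case/negP: Nks; rewrite -fyk.
  by apply: map_f; rewrite mem_filter Ay mem_iota AN.
have: N <= size s.
  rewrite -[N in N <= _](size_iota c); apply: uniq_leq_size;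
      first exact: iota_uniq.
  by move=> k /Ns; rewrite negbK.
rewrite size_map size_filter leqNgt -[X in _ < X](size_iota 0 N).
rewrite ltn_neqAle count_size -all_count andbT.
by case/negP; apply/allPn; exists x; rewrite ?mem_iota.
Qed.

(** The new variable agrees with an old one, or is non-constant, or is a named constant, or is an
    unnamed one. The bound 2 N leaves room for m <= N names and N classes above them. *)
Lemma represents_extend M N m (i : nat -> M) X (A : pred nat) f x :
  X !=set0 -> m <= N -> represents N m i X A f ->
  (forall y, A y -> f y < N + N) ->
  (forall y, A y -> y < N) -> x < N -> ~~ A x ->
  exists i' k, k < N + N /\
    represents N m i' X (fun y => (y == x) || A y) (updf f x k).
Proof.
move=> [s0 Xs0] lemN rep ltf AN ltxN NAx.
have const1 a b y : (forall s, X s -> s.[? y]%fmap = Some a) ->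
    (forall s, X s -> s.[? y]%fmap = Some b) -> a = b.
  by move=> /(_ _ Xs0) Ya /(_ _ Xs0); rewrite Ya => -[].
have [[y Ay Xxy]|Nxy] := pselect (exists2 y, A y &
    forall s, X s -> s.[? x]%fmap = s.[? y]%fmap).
  exists i, (f y); split; first exact: ltf.
  apply: represents_add => // [a|z Az].
    rewrite -(rep_const rep Ay); split=> Xa s Xs; first by rewrite -Xxy ?Xa.
    by rewrite Xxy ?Xa.
  rewrite -(rep_eq rep Ay Az); split=> Xz s Xs; first by rewrite -Xxy ?Xz.
  by rewrite Xxy ?Xz.
have neqx k (Nk : forall y, A y -> f y <> k) y : A y ->
    (forall s, X s -> s.[? x]%fmap = s.[? y]%fmap) <-> k = f y.
  by move=> Ay; split=> [Xxy|/esym/(Nk _ Ay)//]; case: Nxy; exists y.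
have [[a Xa]|Nconst] :=
    pselect (exists a, forall s, X s -> s.[? x]%fmap = Some a);
    last first.
  have [k [lek ltk Nk]] := fresh_value f m AN ltxN NAx.
  exists i, k; split; first lia.
  apply: represents_add => //.
    move=> a; split=> [Xa|[]]; first by case: Nconst; exists a.
    by rewrite ltnNge lek.
  exact: neqx.
have [[k ltk ik]|Na] := pselect (exists2 k, k < m & i k = a).
  exists i, k; split; first lia.
  apply: represents_add => //.
    move=> b; split=> [Xb|[_ ikb]]; first by rewrite ik (const1 _ _ _ Xa Xb).
    by rewrite -ikb ik.
  (* A variable already using the name [k] would agree with [x]. *)
  apply: neqx => y Ay fyk; apply: Nxy; exists y => // s Xs.
  rewrite Xa //; apply/esym; move: s Xs; apply/(rep_const rep Ay).
  by rewrite fyk.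
(* An unnamed element forces [m = N]; fewer than N variables then leave one of the N names idle. *)
have mN : m = N.
  by case: (rep_size rep) => // /(_ a) ?; case: Na.
subst m; have [k [_ ltk Nk]] := fresh_value f 0 AN ltxN NAx.
exists (updf i k a), k; split; first lia.
have Na' p : p < N -> i p <> a by move=> ltp ipa; apply: Na; exists p.
apply: represents_add; rewrite //.
- exact: represents_rename.
- rewrite /updf eqxx => b; split=> [Xb|[_ <-]] //.
  by rewrite (const1 _ _ _ Xa Xb).
- exact: neqx.
Qed.

(** * Back and forth for the quantifiers *)

Lemma represents_update M N m (i : nat -> M) X (A : pred nat) f x a :
  represents N m i X A f ->
  represents N m i (team_update X x a) (fun y => (y != x) && A y) f.
Proof.
have fnd y (s : assignment M) : y != x ->
    (s.[x <- a]).[? y]%fmap = s.[? y]%fmap.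
  by move=> Nyx; rewrite fnd_set (negbTE Nyx).
case=> inj size const eq;
    split=> // [y /andP[Nyx Ay] b|y z /andP[Nyx Ay] /andP[Nzx Az]].
  rewrite -const //; split=> [Xb s Xs|Xb _ [s Xs <-]]; last by rewrite fnd ?Xb.
  by rewrite -(fnd y) // Xb //; exists s.
rewrite -eq //; split=> [Xyz s Xs|Xyz _ [s Xs <-]]; last by rewrite !fnd ?Xyz.
by rewrite -(fnd y) // -(fnd z) // Xyz //; exists s.
Qed.

(** Once [x] is constant with value [i k], another variable agrees with it exactly when it is
    constant with the same value, and injectivity of the names turns this into equality of values of
    [f]. *)
Lemma represents_update_add M N m (i : nat -> M) X (A : pred nat) f x k :
  X !=set0 -> represents N m i X A f -> k < m ->
  represents N m i (team_update X x (i k))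
    (fun y => (y == x) || ((y != x) && A y)) (updf f x k).
Proof.
move=> [s0 Xs0] rep ltk; apply: represents_add.
- exact: represents_update.
- by rewrite eqxx.
- move=> a; split=> [Xa|[_ ika] _ [s Xs <-]]; last by rewrite fnd_set eqxx ika.
  have := Xa s0.[x <- i k]%fmap; rewrite fnd_set eqxx => Xs; split=> //.
  by have [] : Some (i k) = Some a by apply: Xs; exists s0.
- move=> y /andP[Nyx Ay]; split=> [Xxy|kfy _ [s Xs <-]].
    have : f y < m /\ i (f y) = i k.
      apply/(rep_const rep Ay) => s Xs; have := Xxy s.[x <- i k]%fmap.
      by rewrite !fnd_set eqxx (negbTE Nyx) => -> //; exists s.
    by case=> lty /(rep_inj rep lty ltk).
  rewrite !fnd_set eqxx (negbTE Nyx); apply/esym; move: s Xs.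
  by apply/(rep_const rep Ay); rewrite -kfy.
Qed.

Lemma update_neq0 M (X : set (assignment M)) x a :
  X !=set0 -> team_update X x a !=set0.
Proof. by case=> s Xs; exists s.[x <- a]%fmap; exists s. Qed.

Lemma variant_updf N x e e' y : variant N x e e' -> y < N ->
  digit (N + N) e' y = updf (digit (N + N) e) x (digit (N + N) e' x) y.
Proof.
move=> /allP H ltyN; rewrite /updf; case: eqP => [->//|/eqP Nyx].
by have := H y; rewrite mem_iota (negbTE Nyx) => /(_ ltyN) /eqP.
Qed.

Lemma quantifier_back M N m (i : nat -> M) X (A : pred nat) e e' x :
  X !=set0 -> (forall y, A y -> y < N) -> x < N ->
  represents N m i X A (digit (N + N) e) ->
  variant N x e e' -> digit (N + N) e' x < m ->
  represents N m i (team_update X x (i (digit (N + N) e' x)))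
    (fun y => (y == x) || A y) (digit (N + N) e').
Proof.
move=> X0 AN ltxN rep var ltm.
apply: represents_sub (represents_update_add x X0 rep ltm) => y Ay.
split; first by move: Ay; case: eqP.
by apply: variant_updf => //; case/predU1P: Ay => [->//|/AN].
Qed.

(** The element [a] may lack a name, so the naming may change; the new digit is below m because [x]
    is now constant on the team. *)
Lemma quantifier_forth M N m X (A : pred nat) e x (i : nat -> M) a :
  X !=set0 -> m <= N -> (forall y, A y -> y < N) -> x < N ->
  represents N m i X A (digit (N + N) e) ->
  exists i' e', [/\ e' < (N + N) ^ N, variant N x e e', digit (N + N) e' x < m &
    represents N m i' (team_update X x a) (fun y => (y == x) || A y)
     (digit (N + N) e')].
Proof.
move=> X0 lemN AN ltxN rep.
have [||||i' [k [ltk rep']]] :=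
    represents_extend (x := x) (update_neq0 x a X0) lemN
      (represents_update x a rep).
- by move=> y _; rewrite ltn_pmod; lia.
- by move=> y /andP[_ /AN].
- by [].
- by rewrite eqxx.
have [|e' lte' e'E] := @digitsP (N + N) N (updf (digit (N + N) e) x k).
  move=> y _; rewrite /updf; case: eqP => _; first lia.
  by rewrite ltn_pmod; lia.
have e'x : digit (N + N) e' x = k by rewrite e'E // /updf eqxx.
exists i', e'; split=> //.
- apply/allP => y; rewrite mem_iota => ltyN; rewrite e'E // /updf.
  by case: (eqVneq y x) => /= _; rewrite ?eqxx.
- have Axx : (x == x) || ((x != x) && A x) by rewrite eqxx.
  have [Xxa _] := rep_const rep' Axx a; move: Xxa; rewrite /updf eqxx e'x.
  by case=> // _ [s _ <-]; rewrite fnd_set eqxx.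
apply: represents_sub rep' => y Ay; split; first by move: Ay; case: eqP.
by rewrite e'E //; case/predU1P: Ay => [->|/AN].
Qed.

(** The induction is uniform in naming, team and valuation. Since [truth] does not mention the
    naming, a change of names in a forth step does no harm. *)
Lemma sat_truth M N m (i : nat -> M) X (A : pred nat) e phi :
  X !=set0 -> m <= N -> goedel phi <= N -> e < (N + N) ^ N ->
  (forall y, A y -> y < N) ->
  (forall y, y \in free_vars phi -> A y) ->
  represents N m i X A (digit (N + N) e) ->
  sat X phi <-> truth N m (goedel phi) e.
Proof.
move=> X0 lemN; elim: phi i X A e X0 =>
    [x y|p IHp|p IHp q IHq|p IHp q IHq|x p IHp|x p IHp]
  i X A e X0 leN ltB AN fvA rep;
  rewrite truth_goedel //; cbn [sat].
- rewrite (rep_eq rep) ?fvA ?inE ?eqxx ?orbT //.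
  by split=> [->|/eqP].
- have ltp := goedel_ltn (FNeg p).
  have IH := IHp i X A e X0 (leq_trans (ltnW ltp) leN) ltB AN fvA rep.
  split=> [[X0'|/IH/negP//]|/negP NT]; last by right => /IH.
  by case: X0 => s; rewrite X0'.
- have [ltp ltq] := goedel_ltn (FAnd p q).
  have fvp y : y \in free_vars p -> A y by move=> yp; apply: fvA;
      rewrite inE yp.
  have fvq y : y \in free_vars q -> A y.
    by move=> yq; apply: fvA; rewrite inE yq orbT.
  rewrite (IHp i X A e) ?(leq_trans (ltnW ltp)) //.
  rewrite (IHq i X A e) ?(leq_trans (ltnW ltq)) //.
  by split=> [[-> ->]|/andP].
- have [ltp ltq] := goedel_ltn (FOr p q).
  have fvp y : y \in free_vars p -> A y by move=> yp; apply: fvA;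
      rewrite inE yp.
  have fvq y : y \in free_vars q -> A y.
    by move=> yq; apply: fvA; rewrite inE yq orbT.
  rewrite (IHp i X A e) ?(leq_trans (ltnW ltp)) //.
  rewrite (IHq i X A e) ?(leq_trans (ltnW ltq)) //.
  by split=> /orP.
- have [ltx ltp] := goedel_ltn (FEx x p).
  have ltxN := leq_trans ltx leN; have lepN := leq_trans (ltnW ltp) leN.
  have fvp y : y \in free_vars p -> (y == x) || A y.
    by move=> yp; case: eqVneq => //= Nyx; apply: fvA; rewrite !inE Nyx.
  have AxN y : (y == x) || A y -> y < N by case/predU1P=> [->|/AN].
  split=> [[a]|/hasP[e']].
    have [i' [e' [lte' var ltm rep']]] :=
        quantifier_forth a X0 lemN AN ltxN rep.
    rewrite (IHp i' _ _ e' _ _ _ _ _ rep') // => [pe'|];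
        last exact: update_neq0.
    by apply/hasP; exists e'; rewrite ?mem_iota //; apply/and3P.
  rewrite mem_iota => lte' /and3P[var ltm pe'].
  exists (i (digit (N + N) e' x)).
  apply/(IHp i _ _ e' _ _ _ _ _ (quantifier_back X0 AN ltxN rep var ltm)) => //.
  exact: update_neq0.
- have [ltx ltp] := goedel_ltn (FAll x p).
  have ltxN := leq_trans ltx leN; have lepN := leq_trans (ltnW ltp) leN.
  have fvp y : y \in free_vars p -> (y == x) || A y.
    by move=> yp; case: eqVneq => //= Nyx; apply: fvA; rewrite !inE Nyx.
  have AxN y : (y == x) || A y -> y < N by case/predU1P=> [->|/AN].
  split=> [pX|/allP pX a].
    apply/allP => e'; rewrite mem_iota => lte'; rewrite -implybE.
    apply/implyP => /andP[var ltm].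
    apply/(IHp i _ _ e' _ _ _ _ _ (quantifier_back X0 AN ltxN rep var ltm)) =>
        //.
      exact: update_neq0.
  have [i' [e' [lte' var ltm rep']]] := quantifier_forth a X0 lemN AN ltxN rep.
  rewrite (IHp i' _ _ e' _ _ _ _ _ rep') //; last exact: update_neq0.
  by have := pX e'; rewrite mem_iota var ltm => /(_ lte').
Qed.

(** * Correctness of the bounded search *)

(** Elements are named one at a time until N have names or none is left. *)
Lemma exists_enumeration (M : Type) (a0 : M) N :
  exists m (i : nat -> M), [/\ m <= N,
    forall k l, k < m -> l < m -> i k = i l -> k = l &
    m = N \/ forall a, exists2 k, k < m & i k = a].
Proof.
elim: N => [|N [m [i [lemN inj size]]]];
    first by exists 0, (fun=> a0); split=> //; left.
have [surj|/existsNP[a Na]] := pselect (forall a, exists2 k, k < m & i k = a).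
  by exists m, i; split; [exact: leqW | exact: inj | right].
have Na' p : p < m -> i p <> a by move=> ltp ipa; apply: Na; exists p.
case: size => [mN|/(_ a)//]; subst m.
have injN k l : k < N.+1 -> l < N.+1 -> updf i N a k = updf i N a l -> k = l.
  rewrite !ltnS /updf; case: eqP => [->|Nk]; case: eqP => [->|Nl] // lek lel.
  - by move/esym/Na'; case; lia.
  - by move/Na'; case; lia.
  - by apply: inj; lia.
by exists N.+1, (updf i N a); split; [ | exact: injN | left].
Qed.

(** The variables enter one by one through [represents_extend]. The default 0 off [s] keeps all
    digits in range and fits the valuation 0 required for a single constant. *)
Lemma represents_domain M N m (i : nat -> M) X (s : seq nat) :
  X !=set0 -> m <= N -> uniq s -> (forall x, x \in s -> x < N) ->
  represents N m i X pred0 (fun=> 0) ->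
  exists (i' : nat -> M) f, [/\ forall x, x \in s -> f x < N + N,
    forall x, x \notin s -> f x = 0 & represents N m i' X (fun x => x \in s) f].
Proof.
move=> X0 lemN + + rep0; elim: s => [_ _|x s IH /= /andP[Nxs us] sN].
  by exists i, (fun=> 0); split=> //; exact: represents_sub rep0.
have [|i1 [f [ltf f0 rep]]] :=
    IH us; first by move=> y ys; rewrite sN ?inE ?ys ?orbT.
have [|i2 [k [ltk rep2]]] :=
    represents_extend X0 lemN rep ltf _ (sN x (mem_head _ _)) Nxs.
  by move=> y ys; rewrite sN ?inE; rewrite /= ?ys ?orbT.
exists i2, (updf f x k); split.
- by move=> y; rewrite inE /updf; case: eqP => //= _; exact: ltf.
- by move=> y; rewrite inE negb_or /updf => /andP[/negbTE-> /f0].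
- by apply: represents_sub rep2 => y; rewrite /= inE.
Qed.

Lemma truth_of_satisfiable phi : satisfiable phi -> satb (goedel phi).
Proof.
move=> [M [D [X [[a0] fvD teamX X0 satX]]]]; set N := (goedel phi).+2.
have fvN x : x \in free_vars phi -> x < N by move/free_vars_ltn; rewrite /N;
    lia.
have [m [i [lemN inj size]]] := exists_enumeration a0 N.
have rep0 : represents N m i X pred0 (fun=> 0) by split.
have [i' [f [ltf f0 rep]]] :=
    represents_domain X0 lemN (fset_uniq (free_vars phi)) fvN rep0.
have [e lte eE] : exists2 e, e < (N + N) ^ N & forall y, y < N ->
    digit (N + N) e y = f y.
  apply: digitsP => y _; by have [/ltf|/f0->] := boolP (y \in free_vars phi).
have m_gt0 : 0 < m by case: size => [->//|/(_ a0)[k]]; lia.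
have small : m = 1 -> forall y, y < N -> f y = 0.
  move=> m1 y ltyN; have [yfv|/f0//] := boolP (y \in free_vars phi).
  (* As N >= 2, the alternative [m = N] is excluded, so the model has one element. *)
  have surj a : i' 0 = a.
    by case: (rep_size rep) => [|/(_ a)[k]]; rewrite m1 // ltnS leqn0 => /eqP->.
  suff : f y < m by rewrite m1; case: (f y).
  apply: (proj1 (A := _) (B := i' (f y) = i' 0)).
  apply/(rep_const rep yfv) => s Xs.
  have ys : y \in domf s by rewrite (teamX _ Xs) (fsubsetP fvD).
  by rewrite (in_fnd ys); congr Some.
(* For a single constant the search admits only 0, which has the same first N digits as [e]. *)
have [e' [lte' e'E okm]] : exists e, [/\ e < (N + N) ^ N,
    forall y, y < N -> digit (N + N) e y = f y & (0 < m.-1) || (e == 0)].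
  have [m1|m_neq1] := eqVneq m 1; last by exists e; split=> //; lia.
  exists 0; split; rewrite ?expn_gt0 ?eqxx ?orbT //.
  by move=> y /(small m1) ->; rewrite /digit div0n mod0n.
apply/hasP; exists m.-1; first by rewrite mem_iota -/N; lia.
apply/hasP; exists e'; first by rewrite mem_iota.
rewrite okm /= prednK // -/N.
have rep' : represents N m i' X (fun x =>
    x \in free_vars phi) (digit (N + N) e').
  by apply: represents_sub rep => y yfv; split=> //; rewrite e'E ?fvN.
have leN : goedel phi <= N by rewrite /N; lia.
exact/(sat_truth X0 lemN leN lte' fvN (fun _ => id) rep').
Qed.

(** * Realizing a valuation by a team *)

Definition full_assignment (M : Type) N (g : nat -> M) : assignment M :=
  [fmap x : [fset x in iota 0 N]%fset => g (val x)].

Lemma full_assignmentE M N (g : nat -> M) x : x < N ->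
  (full_assignment N g).[? x]%fmap = Some (g x).
Proof.
move=> ltxN; have xD : x \in [fset x in iota 0 N]%fset by rewrite !inE mem_iota.
by rewrite (@in_fnd _ _ (full_assignment N g) _ xD) ffunE.
Qed.

(** The maps [g] are fixed on the constants and arbitrary elsewhere. With two elements, a value
    above m can be moved alone, so it is neither constant nor tied to another value; with one
    element, [e = 0] leaves no such value. *)
Lemma represents_full m N e :
  0 < N -> m.+1 <= N -> (0 < m) || (e == 0) ->
  represents N m.+1 (inord : nat -> 'I_m.+1)
    [set full_assignment N (fun x => g (digit (N + N) e x))
      | g in [set g | forall k, k < m.+1 -> g k = inord k]]
    (fun x => x < N) (digit (N + N) e).
Proof.
move=> N_gt0 ltmN okm.
have m_gt0 x : m < digit (N + N) e x -> 0 < m.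
  by case/orP: okm => // /eqP->; rewrite /digit div0n mod0n; lia.
have inj k l : k < m.+1 -> l < m.+1 -> inord k = inord l :> 'I_m.+1 -> k = l.
  by move=> ltk ltl /(congr1 val); rewrite /= !inordK.
have inXP (P : assignment 'I_m.+1 -> Prop) :
    (forall s, [set full_assignment N (fun x => g (digit (N + N) e x))
      | g in [set g | forall k, k < m.+1 -> g k = inord k]] s -> P s) <->
    forall g, (forall k, k < m.+1 -> g k = inord k :> 'I_m.+1) ->
      P (full_assignment N (fun x => g (digit (N + N) e x))).
  split=> [H g gE|H _ [g gE <-]]; last exact: H.
  by apply: H; exists g.
have sep d b : m < d -> 0 < m -> exists g : nat -> 'I_m.+1,
    (forall k, k < m.+1 -> g k = inord k) /\ g d <> b /\
    forall k, k <> d -> g k = inord k.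
  (* Only the image of [d] changes, to whichever of two distinct elements differs from [b]. *)
  move=> ltd m0; pose v : 'I_m.+1 := if b == ord0 then ord_max else ord0.
  exists (fun k => if k == d then v else inord k); rewrite eqxx; split.
    by move=> k ltk; case: eqP => // kd; lia.
  split; last by move=> k /eqP/negbTE->.
  rewrite /v; case: eqP => [->|Nb] /eqP; last by rewrite eq_sym => /eqP.
  by rewrite -val_eqE /= eqn0Ngt m0.
split.
- exact: inj.
- by right=> a; exists (nat_of_ord a); rewrite ?inord_val ?ltn_ord.
- move=> x ltxN a; rewrite inXP; split=> [H|[ltd <-] g gE]; last first.
    by rewrite full_assignmentE // gE.
  have [lemd|ltmd] := leqP (digit (N + N) e x) m.
    by split=> //; have := H inord (fun _ _ => erefl);
        rewrite full_assignmentE // => -[].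
  have [g [gE [Nga _]]] := sep _ a ltmd (m_gt0 _ ltmd).
  by have := H g gE; rewrite full_assignmentE // => -[].
- move=> x y ltxN ltyN; rewrite inXP; split=> [H|xy g gE]; last first.
    by rewrite !full_assignmentE // xy.
  have {}H g (gE : forall k, k < m.+1 ->
      g k = inord k :> 'I_m.+1) : g (digit (N + N) e x) = g (digit (N + N) e y).
    by have := H g gE; rewrite !full_assignmentE // => -[].
  move: H (m_gt0 x) (m_gt0 y);
      move: (digit _ e x) (digit _ e y) => d d' H dm d'm.
  (* If one of two distinct values is non-constant, [sep] moves it off the image of the other; if
     both are constants, the names are injective. *)
  have [//|Ndd'] := eqVneq d d'.
  have [led|ltd] := leqP d m; last first.
    have [g [gE [Ng gO]]] := sep _ (inord d') ltd (dm ltd).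
    by case: Ng; rewrite (H g gE) gO // => /eqP; rewrite eq_sym (negbTE Ndd').
  have [led'|ltd'] := leqP d' m;
      first exact: (inj _ _ _ _ (H inord (fun _ _ => erefl))).
  have [g [gE [Ng gO]]] := sep _ (inord d) ltd' (d'm ltd').
  by case: Ng; rewrite -(H g gE) gO // => /eqP; rewrite (negbTE Ndd').
Qed.

Lemma satisfiable_of_truth phi : satb (goedel phi) -> satisfiable phi.
Proof.
case/hasP=> m; rewrite mem_iota => /andP[_ ltmN] /hasP[e].
rewrite mem_iota => /andP[_ lte] /andP[okm tr].
move: ltmN lte tr; set N := (goedel phi).+2; rewrite !add0n => ltmN lte tr.
have rep := represents_full (isT : 0 < N) ltmN okm.
set X := (X in represents _ _ _ X _ _) in rep.
have X0 : X !=set0 by eexists; exists inord.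
exists 'I_m.+1, [fset x in iota 0 N]%fset, X; split=> //.
- exact: (inhabits ord0).
- by apply/fsubsetP => x /free_vars_ltn ltx; rewrite !inE mem_iota /N; lia.
- by move=> _ [g _ <-].
apply/(sat_truth X0 ltmN _ lte _ _ rep) => //.
- by rewrite /N; lia.
- by move=> y /free_vars_ltn; rewrite /N; lia.
Qed.

(** * Reduction to satisfiability *)

Lemma satisfiableP phi : satisfiable phi <-> satb (goedel phi).
Proof. by split; [exact: truth_of_satisfiable | exact:
    satisfiable_of_truth]. Qed.

Lemma sat_empty M (phi : formula) : inhabited M ->
    sat (@set0 (assignment M)) phi.
Proof.
move=> [a0].
have upd0 x a : team_update set0 x a = set0 :> set (assignment M).
  by rewrite /team_update image_set0.
elim: phi => [x y|p IHp|p IHp q IHq|p IHp q IHq|x p IHp|x p IHp] //=.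
- by left.
- by left.
- by exists a0; rewrite upd0.
- by move=> a; rewrite upd0.
Qed.

Lemma validP phi : valid phi <-> ~ satisfiable (FNeg phi).
Proof.
split=> [vphi [M [D [X [M0 fvD teamX X0 /=]]]]|Nsat M D X M0 fvD teamX].
  by case=> [XE|]; [case: X0 => s; rewrite XE | apply; exact: (vphi M D)].
have [->|/set0P X0] := eqVneq X set0; first exact: sat_empty.
apply: contrapT => NX; apply: Nsat.
by exists M, D, X; split=> //; right.
Qed.

(** A biconditional on nonempty teams, where negation is classical; the empty team satisfies it as
    well as [p] and [q]. *)
Definition equiv_formula p q := FOr (FAnd p q) (FAnd (FNeg p) (FNeg q)).

Lemma equivalentP p q : equivalent p q <-> valid (equiv_formula p q).
Proof.
have fvE : free_vars (equiv_formula p q) = (free_vars p `|` free_vars q)%fset.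
  by rewrite /= fsetUid.
split=> [pq|vpq] M D X M0 fvD teamX; last first.
  move: fvD; rewrite -fvE => fvD; have /= := vpq M D X M0 fvD teamX.
  have [->|/set0P[s Xs]] := eqVneq X set0; first by split=> _; exact: sat_empty.
  have XN0 : X <> set0 by move=> XE; rewrite XE in Xs.
  by tauto.
move: fvD; rewrite fvE => fvD; have /= := pq M D X M0 fvD teamX.
by have [|] := pselect (sat X p); tauto.
Qed.

(** The reductions negate and combine formulas, so codes of compound formulas must be computed from
    those of their parts. *)
Lemma computable_code_cons F (S : (nat -> nat) -> seq nat) :
  computable F -> computable (fun r => CodeSeq.code (S r)) ->
  computable (fun r => CodeSeq.code (F r :: S r)).
Proof.
move=> cF cS.
have -> : (fun r => CodeSeq.code (F r :: S r)) =
    fun r => 2 ^ F r * (CodeSeq.code (S r) + CodeSeq.code (S r)).+1.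
  by apply/funext => r; rewrite addnn.
apply: computable_mul.
  by apply: computable_exp => //; exact: computable_const.
by apply: computable_succ; exact: computable_add.
Qed.

Lemma computable_code2 k F :
  computable F -> computable (fun r => CodeSeq.code [:: k; F r]).
Proof.
move=> cF; apply: computable_code_cons; first exact: computable_const.
by apply: computable_code_cons => //; exact: computable_const.
Qed.

Lemma computable_code3 k F G : computable F -> computable G ->
  computable (fun r => CodeSeq.code [:: k; F r; G r]).
Proof.
move=> cF cG; apply: computable_code_cons; first exact: computable_const.
apply: computable_code_cons => //; apply: computable_code_cons => //.
exact: computable_const.
Qed.

Lemma decision_value (b : bool) (P : Prop) :
  (P <-> b) -> (P -> b = 1 :> nat) /\ (~ P -> b = 0 :> nat).
Proof.
case: b => [][Pb bP]; split=> //; last by move/Pb.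
by case; exact: bP.
Qed.

Theorem corollary3p7 :
  decidable1 satisfiable /\ decidable1 valid /\ decidable2 equivalent.
Proof.
have cvalid F : computable F ->
    computable (fun r => ~~ satb (CodeSeq.code [:: 1; F r])).
  by move=> cF; apply: computable_neg; apply: computable_satb;
      exact: computable_code2.
have validE phi : valid phi <-> ~~ satb (CodeSeq.code [:: 1; goedel phi]).
  rewrite validP satisfiableP; cbn [goedel]; by split=> /negP.
(* This is [equiv_formula] at the level of codes, so its agreement with [goedel] holds by
   conversion. *)
pose code_equiv m n :=
  CodeSeq.code [:: 3; CodeSeq.code [:: 2; m; n];
    CodeSeq.code [:: 2; CodeSeq.code [:: 1; m]; CodeSeq.code [:: 1; n]]].
split; [|split].
- exists (fun v => satb (nth 0 v 0)); split=> [|phi].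
    by apply: (computable_satb (F := fun r => r 0)); exact: computable_var.
  exact/decision_value/satisfiableP.
- exists (fun v => ~~ satb (CodeSeq.code [:: 1; nth 0 v 0])); split=> [|phi].
    by apply: (cvalid (fun r => r 0)); exact: computable_var.
  exact/decision_value/validE.
- exists (fun v => ~~ satb (CodeSeq.code [:: 1;
      code_equiv (nth 0 v 0) (nth 0 v 1)])).
  split=> [|phi psi]; last first.
    apply: decision_value; rewrite equivalentP validE.
    by [].
  apply: (cvalid (fun r => code_equiv (r 0) (r 1))); rewrite /code_equiv.
  apply: computable_code3; last apply: computable_code3.
  1: apply: computable_code3.
  all: try apply: computable_code2.
  all: exact: computable_var.
Qed.
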